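(* Suppose that the edges of $K_{n,n}$ are partitioned into sets $E_1,E_2,E_3$. Then there exists a perfect matching $F$ in $K_{n,n}$ satisfying $$\left\lceil \frac{|E_i|}{n}\right\rceil+1\ \ge\ |F\cap E_i|\ \ge\ \left\lfloor\frac{|E_i|}{n}\right\rfloor-1$$ for every $i=1,2,3$.
   Context: $K_{n,n}$ is the complete bipartite graph with $n$ vertices on each side ($n\ge 1$). *)

(* Defs.v *)
From mathcomp Require Import all_boot all_order all_algebra.

Set Implicit Arguments.
Unset Strict Implicit.
Unset Printing Implicit Defensive.

(* A simple graph on the vertex type T is given by its edge set, each edge
   being the two-element set of its end vertices. *)

Definition complete_bipartite (A B : finType) : {set {set (A + B)%type}} :=
  [set [set inl a; inr b] | a : A, b : B].

Definition matching (T : finType) (G F : {set {set T}}) : bool :=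
  (F \subset G) && trivIset F.

Definition perfect_matching (T : finType) (G F : {set {set T}}) : bool :=
  matching G F && (cover F == [set: T]).

(* Main.v *)
Require Import Defs.
From mathcomp Require Import all_boot all_order all_algebra.
From mathcomp Require Import all_fingroup ring lra zify.

Set Implicit Arguments.
Unset Strict Implicit.
Unset Printing Implicit Defensive.

Import Order.TTheory GRing.Theory Num.Theory.
Local Open Scope ring_scope.

(** A perfect matching of [K_{n,n}] is a permutation [p], and a partition of
    the edges into three parts is a colouring of the cells of an [n x n] square
    by three colours. Let the deviation of [p] be the vector whose [i]-th
    coordinate is the number of edges of colour [i] in [p] minus [|E_i| / n].
    Deviations live in the plane of triples with sum zero, and it is enough to
    find a [p] whose deviation has all coordinates less than [2] in absolute
    value. Suppose that there is none. Then all deviations are far from the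
    origin, at distance at least [sqrt 3] if the lattice of integer triples
    with sum zero has minimal distance [1], whereas a transposition moves the
    deviation by at most [2], so that it turns it around the origin by an angle
    less than 71 degrees.

    Four such steps turn by less than a full angle, hence a four-cycle of
    transpositions does not wind around the origin. Since four-cycles generate
    all cycles of the Cayley graph of the symmetric group on the transpositions
    (lemma [potential_exists]), no closed walk winds: the angle of the
    deviation lifts to a real-valued function on permutations. Only its integer
    part in half-turns is used; it is the potential [K] of the crossing number
    [turn].

    On the other hand (lemma [walk]), let two permutations [p] and [q] have
    their deviations in the closed half-plane [dot u >= 0]. Each cycle of the
    union of the two matchings can be switched from [p] to [q] edge by edge,
    using at each moment only one edge outside [p] and [q]; by the cycle lemma
    a suitable starting point keeps the partial sums on the correct side of the
    line. The one foreign edge costs at most the distance [1], which is too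
    little to pass behind the origin (lemma [turn_halfplane]). So the lifted
    angle changes from [p] to [q] exactly as it does inside the half-plane.
    Any two deviations lie in such a half-plane, and opposite ones lie in two
    of them, which prescribe the changes [pi] and [- pi]; so there are no
    opposite ones, and all lifted angles are less than [pi] apart. All the
    deviations then lie in an open half-plane.

    This is absurd: the [n] cyclic shifts partition the square, so their
    deviations have sum zero (lemma [lift_unbalanced]). *)

(** * Signed half-turns in the plane *)

Section Plane.
Variable R : realFieldType.
Implicit Types m u x y z : R * R.

Definition det x y : R := x.1 * y.2 - x.2 * y.1.

(** A point [x] stands for the triple [(x.1, x.2, - x.1 - x.2)] of the plane of
    triples with sum zero; [dot] is the standard inner product of triples. *)
Definition dot x y : R := x.1 * y.1 + x.2 * y.2 + (x.1 + x.2) * (y.1 + y.2).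

(** The half-plane is half-open, so that for nonzero [x] exactly one of [x] and
    [- x] belongs to it. *)
Definition upper x := (0 < x.2) || (x.2 == 0) && (0 < x.1).

(** The change of the number of completed half-turns when the direction moves
    from [x] to [y] by an angle less than pi: the signed number of crossings of
    the horizontal axis. *)
Definition turn x y : int := if upper x == upper y then 0 else sgz (det x y).

Lemma detC x y : det y x = - det x y.
Proof. by rewrite /det; ring. Qed.

Lemma turnC x y : turn y x = - turn x y.
Proof. by rewrite /turn eq_sym; case: eqP => // _; rewrite detC sgzN. Qed.

Lemma upperN x : x != 0 -> upper (- x) = ~~ upper x.
Proof.
case: x => x1 x2; rewrite /upper xpair_eqE /= oppr_eq0 !oppr_gt0.
by case: (ltrgt0P x2) => //= _; case: (ltrgt0P x1).
Qed.

(** A half-plane is a convex cone. *)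
Lemma upper_cone a b c x y z : 0 < a -> 0 <= b -> 0 < c ->
  x != 0 -> y != 0 -> upper x = upper y ->
  c * z.1 = a * x.1 + b * y.1 -> c * z.2 = a * x.2 + b * y.2 ->
  upper z = upper x.
Proof.
move=> a0 b0 c0 xn yn.
have pos x' y' z' : upper x' -> upper y' -> c * z'.1 = a * x'.1 + b * y'.1 ->
    c * z'.2 = a * x'.2 + b * y'.2 -> upper z'.
  move: x' y' z' => [x1 x2] [y1 y2] [z1 z2]; rewrite /upper /=.
  move=> hx hy e1 e2.
  rewrite -(pmulr_rgt0 _ c0) -(pmulr_rgt0 z1 c0) e1 e2.
  have -> : (z2 == 0) = (a * x2 + b * y2 == 0).
    by rewrite -e2 mulf_eq0 (gt_eqF c0).
  have x2_ge0 : 0 <= x2.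
    by case/orP: hx => [/ltW|/andP[/eqP->]].
  have y2_ge0 : 0 <= y2.
    by case/orP: hy => [/ltW|/andP[/eqP->]].
  have by_ge0 : 0 <= b * y2 by rewrite mulr_ge0.
  case/orP: hx => [x2p|/andP[/eqP-> x1p]].
    by rewrite ltr_wpDr // mulr_gt0.
  rewrite mulr0 add0r lt0r by_ge0 andbT; case: eqP => //= /eqP.
  rewrite mulf_eq0; case/orP => [/eqP->|/eqP y20].
    by rewrite mul0r addr0 mulr_gt0.
  move: hy; rewrite y20 ltxx eqxx /= => y1p.
  by rewrite ltr_wpDr ?mulr_gt0 // mulr_ge0 // ltW.
move=> hxy e1 e2; case: (boolP (upper x)) => hx.
  by apply: pos e1 e2; rewrite -?hxy.
have zn : z != 0.
  apply: contraNneq (hx) => z0.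
  have ux : upper (- x) by rewrite upperN.
  have uy : upper (- y) by rewrite upperN // -hxy.
  have: upper 0 by apply: (pos _ _ 0 ux uy); move: e1 e2; rewrite z0 /=; lra.
  by rewrite /upper /= ltxx andbF.
apply: negbTE; rewrite -upperN //.
by apply: (pos (- x) (- y)); rewrite ?upperN -?hxy //=; lra.
Qed.

Lemma dot_neq0 m x : 0 < dot m x -> x != 0.
Proof.
by apply: contraTneq => ->; rewrite /dot /= addr0 !mulr0 !addr0 ltxx.
Qed.

(** Otherwise [z] would be a nonnegative combination of [x] and [y], by the
    linear relation between three vectors of the plane. The factor [s] serves
    for the two orientations. *)
Lemma same_side s m x y z : 0 < dot m x -> 0 < dot m y -> 0 < dot m z ->
  upper x = upper y -> upper x != upper z ->
  0 < s * det y z -> 0 < s * det x z.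
Proof.
move=> mx my mz hxy hxz dyz; rewrite ltNge; apply: contra hxz => dxz.
have e1 : - (s * det x y) * z.1 = s * det y z * x.1 + - (s * det x z) * y.1.
  by rewrite /det; ring.
have e2 : - (s * det x y) * z.2 = s * det y z * x.2 + - (s * det x z) * y.2.
  by rewrite /det; ring.
have e : - (s * det x y) * dot m z =
    s * det y z * dot m x + - (s * det x z) * dot m y.
  by rewrite /det /dot; ring.
have dxy : 0 < - (s * det x y).
  rewrite -(pmulr_lgt0 _ mz) e; apply: ltr_wpDr; last exact: mulr_gt0.
  by apply: mulr_ge0; [rewrite oppr_ge0 | apply: ltW].
rewrite eq_sym; apply/eqP; apply: (upper_cone dyz _ dxy _ _ hxy e1 e2).
- by rewrite oppr_ge0.
- exact: dot_neq0 mx.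
- exact: dot_neq0 my.
Qed.

Lemma sgz_det_side m x y z : 0 < dot m x -> 0 < dot m y -> 0 < dot m z ->
  upper x = upper y -> upper x != upper z -> sgz (det x z) = sgz (det y z).
Proof.
move=> mx my mz hxy hxz.
have hyz : upper y != upper z by rewrite -hxy.
have P s : (0 < s * det x z) = (0 < s * det y z).
  by apply/idP/idP; apply: (same_side (m := m)).
have := P 1; have := P (-1); rewrite !mul1r !mulN1r !oppr_gt0.
by case: (sgzP (det x z)); case: (sgzP (det y z)).
Qed.

(** Three directions in an open half-plane do not surround the origin, so
    turning through them and back makes no net crossing of the axis. *)
Lemma turn_cocycle m x y z : 0 < dot m x -> 0 < dot m y -> 0 < dot m z ->
  turn x y + turn y z + turn z x = 0.
Proof.
move=> mx my mz; have S := @sgz_det_side m.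
rewrite /turn; case: (boolP (upper x == upper y)) => [/eqP hxy|hxy].
  rewrite -hxy (eq_sym (upper z)); case: ifP => [//|/negbT hxz].
  by rewrite (detC x z) sgzN (S x y z) //; ring.
case: (boolP (upper y == upper z)) => [/eqP hyz|hyz].
  rewrite -hyz eq_sym (negbTE hxy) (detC y x) sgzN (S y z x) // 1?eq_sym //.
  by ring.
have hzx : upper z = upper x.
  by move: hxy hyz; case: (upper x); case: (upper y); case: (upper z).
rewrite hzx eqxx (detC z y) sgzN (S x z y) ?hzx //; ring.
Qed.

Lemma turn_trans m x y z : 0 < dot m x -> 0 < dot m y -> 0 < dot m z ->
  turn x y + turn y z = turn x z.
Proof.
by move=> mx my mz; have := turn_cocycle mx my mz; rewrite (turnC x z); lia.
Qed.

(** In units where [e_0], [e_1], [e_2] are at mutual distance one, [dot x x] is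
    twice the squared length: [far] means length at least [sqrt 3], and [close]
    means distance at most [2]. Seen from the origin, two far and close points
    are thus less than a right angle apart. *)
Definition far x := 6 <= dot x x.
Definition close x y := dot (x - y) (x - y) <= 8.

Lemma dotC x y : dot x y = dot y x.
Proof. by rewrite /dot; ring. Qed.

Lemma far_close x y : far x -> far y -> close x y -> 2 <= dot x y.
Proof.
rewrite /far /close => fx fy.
have -> : dot (x - y) (x - y) = dot x x + dot y y - 2 * dot x y.
  by rewrite /dot /=; ring.
by lra.
Qed.

(** The middle point makes an acute angle with both others. *)
Lemma turn_step x y z : far x -> far y -> far z -> close x y -> close y z ->
  turn x y + turn y z = turn x z.
Proof.
move=> fx fy fz cxy cyz; apply: (@turn_trans y).
- by rewrite dotC (lt_le_trans _ (far_close fx fy cxy)).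
- exact: lt_le_trans fy.
- by rewrite (lt_le_trans _ (far_close fy fz cyz)).
Qed.

Lemma turn_square x y z t : far x -> far y -> far z -> far t ->
  close x y -> close y z -> close z t -> close t x ->
  turn x y + turn y z + turn z t + turn t x = 0.
Proof.
move=> fx fy fz ft cxy cyz czt ctx.
by rewrite turn_step // -addrA (turn_step fz) // (turnC z x); lia.
Qed.

(** The half-plane [- w <= dot u x] may contain the origin in its interior by a
    margin [w], but the far points leave a gap in the direction opposite to
    [u] which is too wide for a step. Hence along steps inside it the
    half-turns counted from [u] are well defined. *)
Lemma turn_halfplane w u x y : 0 < w -> w ^+ 2 <= 2 * dot u u ->
  far x -> far y -> close x y -> - w <= dot u x -> - w <= dot u y ->
  turn u y - turn u x = turn x y.
Proof.
move=> w0 wu fx fy cxy ux uy; have xy := far_close fx fy cxy.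
(* [u] tilted towards the two points: enough to become positive on them,
   too little to become negative on [u] itself. *)
pose m : R * R := (6 * u.1 + w * (x.1 + y.1), 6 * u.2 + w * (x.2 + y.2)).
have mE z : dot m z = 6 * dot u z + w * (dot x z + dot y z).
  by rewrite /dot /m /=; ring.
have ww : 0 < w ^+ 2 by rewrite exprn_gt0.
have mu : 0 < dot m u.
  have: w * (- w - w) <= w * (dot x u + dot y u).
    by rewrite ler_pM2l // lerD // dotC.
  by rewrite mE; nra.
have mx : 0 < dot m x.
  have: w * (6 + 2) <= w * (dot x x + dot y x).
    by rewrite ler_pM2l // lerD // dotC.
  by rewrite mE; lra.
have my : 0 < dot m y.
  have: w * (2 + 6) <= w * (dot x y + dot y y) by rewrite ler_pM2l // lerD.
  by rewrite mE; lra.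
by have := turn_trans mu mx my; lia.
Qed.

(** The clockwise quarter-turn for the inner product [dot], scaled by
    [sqrt 3]. *)
Definition perp x : R * R := (x.1 + 2 * x.2, - 2 * x.1 - x.2).

Lemma dot_perp x y : dot (perp x) y = - 3 * det x y.
Proof. by rewrite /dot /perp /det /=; ring. Qed.

Lemma det_perp x : det (perp x) x = dot x x.
Proof. by rewrite /dot /perp /det /=; ring. Qed.

Lemma dot_gt0 x : x != 0 -> 0 < dot x x.
Proof.
case: x => a b; rewrite xpair_eqE negb_and /dot /= => h.
have : 0 < a ^+ 2 + b ^+ 2.
  case/orP: h => h; first by rewrite ltr_wpDr ?sqr_ge0 // exprn_even_gt0.
  by rewrite ltr_wpDl ?sqr_ge0 // exprn_even_gt0.
by have := sqr_ge0 (a + b); nra.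
Qed.

Lemma perp_neq0 x : x != 0 -> perp x != 0.
Proof.
move=> /dot_gt0; rewrite -det_perp; apply: contraTneq => ->.
by rewrite /det !mul0r subrr ltxx.
Qed.

(** The last two conditions place [y] in the convex cone of [perp x] and
    [x]. *)
Lemma upper_perp x y : x != 0 -> y != 0 -> upper (perp x) = upper x ->
  det x y <= 0 -> 0 <= det (perp x) y -> upper y = upper x.
Proof.
move=> xn yn; have := perp_neq0 xn; have := dot_gt0 xn.
rewrite -det_perp; set u := perp x => dux un ux dxy duy.
have e1 : det u x * y.1 = det u y * x.1 + - det x y * u.1 by rewrite /det; ring.
have e2 : det u x * y.2 = det u y * x.2 + - det x y * u.2 by rewrite /det; ring.
have dxy' : 0 <= - det x y by rewrite oppr_ge0.
have [duy0|duy0] := eqVneq (det u y) 0; last first.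
  have duy' : 0 < det u y by rewrite lt0r duy0.
  exact: (upper_cone duy' dxy' dux xn un (esym ux) e1 e2).
have [dxy0|dxy0] := eqVneq (det x y) 0.
  move: e1 e2; rewrite duy0 dxy0 oppr0 !mul0r addr0 => /eqP e1 /eqP e2.
  move: e1 e2 yn; rewrite !mulf_eq0 (gt_eqF dux) /= => y1 y2.
  by rewrite [y]surjective_pairing xpair_eqE y1 y2.
rewrite -ux; move: e1 e2; rewrite addrC [in X in _ -> X -> _]addrC => e1 e2.
apply: (upper_cone _ duy dux un xn ux e1 e2).
by rewrite oppr_gt0 lt_neqAle dxy0.
Qed.

Lemma hexagon_bound (a b : R) : `|a| <= 2 -> `|b| <= 2 -> `|a + b| <= 2 ->
  a * a + b * b + (a + b) * (a + b) <= 8.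
Proof.
rewrite !ler_norml => /andP[a1 a2] /andP[b1 b2] /andP[s1 s2].
have [a0|a0] := lerP 0 a; have [b0|b0] := lerP 0 b;
  have [s0|s0] := lerP 0 (a + b); nra.
Qed.

End Plane.

(** * Half-turn counts force imbalance *)

(** A count of half-turns [K] that agrees, for any two points of a closed
    half-plane, with the count inside that half-plane: the directions of the
    points [v i] can then be lifted to angles less than pi apart. *)
Section Lift.
Variables (R : realFieldType) (I : finType) (v : I -> R * R) (K : I -> int).
Hypothesis v_neq0 : forall i, v i != 0.
Hypothesis K_lift : forall i j u, u != 0 -> 0 <= dot u (v i) ->
  0 <= dot u (v j) -> K j - K i = turn u (v j) - turn u (v i).

Lemma lift_perp i j : det (v i) (v j) <= 0 ->
  K j - K i = turn (perp (v i)) (v j) - turn (perp (v i)) (v i).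
Proof.
move=> dij; apply: K_lift; rewrite ?dot_perp.
- exact: perp_neq0.
- by rewrite /det [_.2 * _]mulrC subrr mulr0.
- by rewrite mulNr oppr_ge0 pmulr_rle0.
Qed.

(** All directions lie within less than pi of each other after lifting, so more
    half-turns mean a counterclockwise position. If not, both points would lie
    in the closed half-plane around the direction at a right angle clockwise
    from [v i], and there [v j] comes before [v i]. *)
Lemma lift_det i j : K i < K j -> 0 < det (v i) (v j).
Proof.
move=> Kij; rewrite ltNge; apply/negP => dij.
have := lift_perp dij; set x := v i in dij *; set y := v j in dij *.
have dux : 0 < det (perp x) x by rewrite det_perp dot_gt0 // v_neq0.
rewrite /turn; case: (eqVneq (upper (perp x)) (upper x)) => [ux|ux].
  case: (eqVneq (upper (perp x)) (upper y)) => [_|uy]; first lia.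
  case: (sgzP (det (perp x) y)) => [_|duy|_]; try lia.
  move=> _; case/eqP: uy; rewrite ux; apply/esym.
  by apply: upper_perp (ltW duy); rewrite ?v_neq0.
rewrite (gtr0_sgz dux); case: ifP => _; first lia.
by case: (sgzP (det (perp x) y)); lia.
Qed.

Lemma lift_upper i j : K i = K j -> upper (v i) = upper (v j).
Proof.
wlog dij : i j / det (v i) (v j) <= 0 => [H Kij|].
  case: (lerP (det (v i) (v j)) 0) => [|d]; first by move/H; apply.
  by apply/esym/H; rewrite ?Kij // detC oppr_le0 ltW.
move=> Kij; apply/eqP/negPn/negP => hxy.
have := lift_perp dij; set x := v i in dij hxy *; set y := v j in dij hxy *.
have dux : 0 < det (perp x) x by rewrite det_perp dot_gt0 // v_neq0.
rewrite Kij subrr /turn; case: (eqVneq (upper (perp x)) (upper x)) => [ux|ux].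
  rewrite ux (negbTE hxy) subr0 => /esym/eqP; rewrite sgz_cp0 => /eqP duy.
  case/eqP: hxy; apply/esym.
  by apply: upper_perp => //; rewrite ?v_neq0 ?duy.
have -> : upper (perp x) = upper y.
  by move: ux hxy; case: (upper (perp x)); case: (upper x); case: (upper y).
by rewrite eqxx (gtr0_sgz dux).
Qed.

Lemma upper_sum (J : finType) (z : J -> R * R) (j0 : J) :
  (forall j, upper (z j)) -> \sum_j (z j).2 = 0 -> \sum_j (z j).1 != 0.
Proof.
move=> zu s2.
have z2_ge0 j : 0 <= (z j).2.
  by case/orP: (zu j) => [/ltW|/andP[/eqP->]].
have z2 j : (z j).2 = 0.
  by move/psumr_eq0P: s2 => ->.
have z1 j : 0 < (z j).1.
  by have := zu j; rewrite /upper z2 ltxx eqxx.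
rewrite gt_eqF // (bigD1 j0) //= ltr_wpDr // sumr_ge0 // => j _.
exact: ltW.
Qed.

(** Suppose that a family of points has sum zero. Splitting it according to the
    value of [K] gives two sums [U] and [- U], so the sum of all determinants
    across the split is [det U (- U) = 0], while each of them is positive;
    hence [K] is constant and all the points lie in one half-plane. *)
Lemma lift_unbalanced (J : finType) (p : J -> I) (j0 : J) :
  \sum_j (v (p j)).1 = 0 -> \sum_j (v (p j)).2 != 0.
Proof.
move=> s1; apply/eqP => s2.
have Kle i j : K (p j) <= K (p i).
  rewrite leNgt; apply/negP => Kij.
  pose S := [pred l | K (p l) <= K (p i)].
  pose U1 := \sum_(l | S l) (v (p l)).1; pose U2 := \sum_(l | S l) (v (p l)).2.
  have W1 : \sum_(l | ~~ S l) (v (p l)).1 = - U1.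
    by apply/eqP; rewrite -addr_eq0 addrC; move: s1; rewrite (bigID S) => /= ->.
  have W2 : \sum_(l | ~~ S l) (v (p l)).2 = - U2.
    by apply/eqP; rewrite -addr_eq0 addrC; move: s2; rewrite (bigID S) => /= ->.
  have: \sum_(l | S l) \sum_(r | ~~ S r) det (v (p l)) (v (p r)) = 0.
    transitivity (\sum_(l | S l) ((v (p l)).1 * - U2 - (v (p l)).2 * - U1)).
      by apply: eq_bigr => l _; rewrite sumrB -!mulr_sumr W1 W2.
    by rewrite sumrB -!mulr_suml -/U1 -/U2; ring.
  apply/eqP; rewrite gt_eqF //.
  have D l r : S l -> ~~ S r -> 0 < det (v (p l)) (v (p r)).
    rewrite /= -ltNge => Kl Kr; apply: lift_det; exact: le_lt_trans Kl Kr.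
  have Si : S i by rewrite /=.
  have Sj : ~~ S j by rewrite /= -ltNge.
  rewrite (bigD1 i) //= ltr_wpDr //.
    by apply: sumr_ge0 => l /andP[Sl _]; apply: sumr_ge0 => r Sr; apply/ltW/D.
  rewrite (bigD1 j) //= ltr_wpDr ?D //.
  by apply: sumr_ge0 => r /andP[Sr _]; apply/ltW/D.
have up j : upper (v (p j)) = upper (v (p j0)).
  by apply: lift_upper; apply: le_anti; rewrite !Kle.
case: (boolP (upper (v (p j0)))) => h.
  have := @upper_sum _ (v \o p) j0; rewrite /= s1 s2 eqxx => /(_ _ erefl) H.
  by have: false by apply: H => j; rewrite up.
have := @upper_sum _ (fun j => - v (p j)) j0.
rewrite /= !sumrN s1 s2 oppr0 eqxx => /(_ _ erefl) H.
by have: false by apply: H => j; rewrite upperN // up.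
Qed.

End Lift.

(** * Closed four-cycles of transpositions suffice for a potential *)

Section Transpositions.
Variable T : finType.
Implicit Types (p q : {perm T}) (a b m : T).

Definition adj p q := exists a b, q = (tperm a b * p)%g.

Lemma adjC p q : adj p q -> adj q p.
Proof. by case=> a [b ->]; exists a, b; rewrite mulgA tperm2 mul1g. Qed.

Lemma adj_refl p q : adj p q -> adj p p.
Proof. by case=> a _; exists a, a; rewrite tperm1 mul1g. Qed.

(** The standard step of sorting by transpositions. *)
Definition fix_at m p := (tperm m (p^-1 m) * p)%g.

Lemma adj_fix_at m p : adj p (fix_at m p).
Proof. by exists m, (p^-1 m)%g. Qed.

Lemma fix_atE m p : fix_at m p m = m.
Proof. by rewrite permM tpermL permKV. Qed.

Lemma fix_at_id m p x : p x = x -> fix_at m p x = x.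
Proof.
move=> px; have [->|xm] := eqVneq x m; first exact: fix_atE.
rewrite permM tpermD // 1?eq_sym //.
by apply: contraNneq xm => e; rewrite -px e permKV.
Qed.

Lemma tperm_slide a b m : m != b -> b != a -> m != a ->
  (tperm m b * tperm b a = tperm b a * tperm m a)%g.
Proof.
by move=> mb ba ma; rewrite conjgC tpermJ tpermL tpermD // eq_sym.
Qed.

(** Sorting steps from the two ends of an edge of the Cayley graph close up to
    a four-cycle, possibly a degenerate one. *)
Lemma adj_fix_at2 m p q : adj p q -> adj (fix_at m p) (fix_at m q).
Proof.
case=> a [b ->]; rewrite /fix_at invMg tpermV permM.
set y := (p^-1 m)%g; set t := tperm a b.
suff [c [d H]] : exists c d, (tperm m (t y) * t = tperm c d * tperm m y)%g.
  by exists c, d; rewrite !mulgA H.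
have -> : (tperm m (t y) * t = t * tperm (t m) y)%g.
  by rewrite conjgC tpermJ /t tpermK.
(* Either [t] fixes [m], or [m] may be taken to be [a]. *)
wlog : a b @t / m = a \/ (m != a /\ m != b) => [H|].
  have [ma|ma] := eqVneq m a; first by apply: H; left.
  have [mb|mb] := eqVneq m b; last by apply: H; right.
  by have := H b a (or_introl mb); rewrite tpermC.
case=> [->|[ma mb]]; last by exists a, b; rewrite /t tpermD // eq_sym.
rewrite /t tpermL.
have [->|ab] := eqVneq a b; first by exists b, b; rewrite tperm1 mul1g.
have [->|yb] := eqVneq y b.
  by exists b, b; rewrite !tperm1 mulg1 mul1g.
have [->|ya] := eqVneq y a.
  by exists b, b; rewrite !tperm1 (tpermC b a) tperm2 mulg1.
by exists b, y; rewrite tperm_slide // eq_sym.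
Qed.

Section Potential.
Variable c : {perm T} -> {perm T} -> int.
Hypothesis c_square : forall p q r s,
  adj p q -> adj q r -> adj r s -> adj s p -> c p q + c q r + c r s + c s p = 0.

Lemma cost_refl p q : adj p q -> c p p = 0.
Proof. by move/adj_refl => e; have := c_square e e e e; lia. Qed.

Lemma costC p q : adj p q -> c q p = - c p q.
Proof.
move=> pq; have e := adj_refl pq.
by have := c_square pq (adjC pq) e e; rewrite (cost_refl pq); lia.
Qed.

Fixpoint sort_along s p :=
  if s is m :: s' then sort_along s' (fix_at m p) else p.

Fixpoint sort_cost s p : int :=
  if s is m :: s' then c (fix_at m p) p + sort_cost s' (fix_at m p) else 0.

Lemma sort_cost_adj s p q : adj p q ->
  c p q = sort_cost s q - sort_cost s p + c (sort_along s p) (sort_along s q).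
Proof.
elim: s p q => [|m s IH] p q pq /=; first by rewrite subrr add0r.
have pq' := adj_fix_at2 m pq.
have := c_square pq (adj_fix_at m q) (adjC pq') (adjC (adj_fix_at m p)).
by rewrite (costC pq') (costC (adj_fix_at m q)) (IH _ _ pq'); lia.
Qed.

Lemma sort_along_id s p x : x \in s \/ p x = x -> sort_along s p x = x.
Proof.
elim: s p => [|m s IH] p /=; first by case.
rewrite inE => H; apply: IH; case: H => [/orP[/eqP->|xs]|px]; last 2 first.
- by left.
- by right; apply: fix_at_id.
by right; apply: fix_atE.
Qed.

(** The Cayley graph generated by all transpositions becomes simply connected
    when its four-cycles are filled in: the potential is the cost of sorting
    down to the identity, each step of which crosses four-cycles only. *)
Lemma potential_exists : exists K : {perm T} -> int,
  forall p q, adj p q -> c p q = K q - K p.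
Proof.
exists (sort_cost (enum T)) => p q pq; rewrite (sort_cost_adj (enum T) pq).
have E r : sort_along (enum T) r = 1%g.
  by apply/permP => x; rewrite sort_along_id ?perm1 // mem_enum; left.
case: (pq) => a _; rewrite !E (@cost_refl _ (tperm a a)) ?addr0 //.
by exists a, a; rewrite mulg1.
Qed.

End Potential.
End Transpositions.

(** * Walking between two permutations on one side of a line *)

Section CyclicSums.
Variables (T : finType) (R : realFieldType) (s : {perm T}) (d : T -> R).

Definition orbit_sum x k : R := \sum_(0 <= i < k) d (iter i s x).

Lemma orbit_sumD x k l :
  orbit_sum x (k + l) = orbit_sum x k + orbit_sum (iter k s x) l.
Proof.
rewrite /orbit_sum (big_cat_nat (n := k)) ?leq_addr //=; congr (_ + _).
rewrite -{1}[k]add0n big_addn addKn; apply: eq_bigr => i _.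
by rewrite iterD.
Qed.

Lemma orbit_sum_porbit x :
  orbit_sum x #|porbit s x| = \sum_(y in porbit s x) d y.
Proof.
rewrite (eq_bigl (mem (traject s x #|porbit s x|))); last exact: porbit_traject.
rewrite -big_uniq ?uniq_traject_porbit // /orbit_sum.
rewrite (big_nth x) size_traject.
by apply: eq_big_nat => i /= iL; rewrite nth_traject.
Qed.

(** The cycle lemma: start where the partial sums are least. *)
Lemma good_start x0 : 0 <= \sum_(y in porbit s x0) d y ->
  exists2 x, x \in porbit s x0 & forall k, 0 <= orbit_sum x k.
Proof.
rewrite -orbit_sum_porbit; set L := #|_| => L_ge0.
have L0 : (0 < L)%N by rewrite lt0n card_porbit_neq0.
have [k0 _ kmin] := @arg_minP _ _ _ (Ordinal L0) xpredT (orbit_sum x0 \o val) isT.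
exists (iter k0 s x0); first by rewrite -permX mem_porbit.
suff H k : orbit_sum x0 k0 <= orbit_sum x0 k.
  by move=> k; have := H (k0 + k)%N; rewrite orbit_sumD; lra.
elim/ltn_ind: k => k IH; have [kL|Lk] := ltnP k L.
  exact: (kmin (Ordinal kL)).
rewrite -(subnKC Lk) orbit_sumD iter_porbit.
apply: le_trans (IH (k - L)%N _) _; first by rewrite ltn_subrL L0 (leq_trans L0).
by rewrite lerDr.
Qed.

End CyclicSums.

Section Walk.
Variables (T : finType) (R : realFieldType) (W : T -> T -> R).
Implicit Types (p q : {perm T}) (x y : T).

Definition total p : R := \sum_x W x (p x).

Lemma total_tperm p x y : x != y ->
  total (tperm x y * p)%g =
  total p + (W x (p y) + W y (p x) - W x (p x) - W y (p y)).
Proof.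
move=> xy; have yx : y != x by rewrite eq_sym.
rewrite /total (bigD1 x) // (bigD1 y) //=.
rewrite [in RHS](bigD1 x) // [in RHS](bigD1 y) //=.
rewrite !permM tpermL tpermR.
rewrite (eq_bigr (fun z => W z (p z))); first by ring.
by move=> z /andP[zx zy]; rewrite permM tpermD // eq_sym.
Qed.

Section Orbit.
Variables (p s : {perm T}) (x : T).
Let r i := iter i s x.
Let gain y := W y (p (s y)) - W y (p y).

(** Along the orbit of [x], the values of [p] are replaced one by one by those
    of [p \o s]; the value [p x] set free at the start travels along. *)
Fixpoint advance k :=
  if k is k'.+1 then (tperm (r k') (r k'.+1) * advance k')%g else p.

Lemma orbit_inj i j : (i < #|porbit s x|)%N -> (j < #|porbit s x|)%N ->
  r i = r j -> i = j.
Proof.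
move=> iL jL; have := uniq_traject_porbit s x => /uniqP-/(_ x i j).
by rewrite !inE !size_traject !nth_traject //; apply.
Qed.

(** Each permutation on the way takes, except at the single place [r k], only
    values of [p] and of [p \o s]. *)
Lemma advance_spec k : (k < #|porbit s x|)%N ->
  [/\ forall i, (i < k)%N -> advance k (r i) = p (r i.+1),
      advance k (r k) = p x,
      forall y, (forall i, (i <= k)%N -> y != r i) -> advance k y = p y &
      total (advance k) = total p + orbit_sum s gain x k
                          + (W (r k) (p x) - W (r k) (p (r k)))].
Proof.
elim: k => [|k IH] kL /=.
  by split=> //; rewrite /orbit_sum big_geq //= subrr !addr0.
have [lo at_ hi tot] := IH (ltnW kL).
have rk i : (i <= k)%N -> r i != r k.+1.
  move=> ik; apply/eqP => /orbit_inj e.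
  have := e (leq_ltn_trans ik (ltnW kL)) kL.
  by move=> ik1; rewrite ik1 ltnn in ik.
have hik : advance k (r k.+1) = p (r k.+1).
  by apply: hi => i ik; rewrite eq_sym rk.
split.
- move=> i; rewrite ltnS leq_eqVlt => /orP[/eqP->|ik].
    by rewrite permM tpermL hik.
  rewrite permM tpermD ?lo //; last by rewrite eq_sym rk // ltnW.
  apply/eqP => /orbit_inj e; have := e (ltnW kL) (ltn_trans ik (ltnW kL)).
  by move=> ki; rewrite ki ltnn in ik.
- by rewrite permM tpermR at_.
- move=> y yr; rewrite permM tpermD; last 2 first.
  + by rewrite eq_sym; apply: (yr k); apply: leqnSn.
  + by rewrite eq_sym; apply: (yr k.+1).
  by apply: hi => i ik; apply: yr; apply: leqW.
- rewrite total_tperm ?rk // tot at_ hik /orbit_sum big_nat_recr //= /gain -/(r k).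
  by rewrite -[s (r k)]/(r k.+1); ring.
Qed.

End Orbit.

Variables (w t : R) (C : Type) (f : {perm T} -> C).
Hypothesis W_osc : forall x y x' y', W x y - W x' y' <= w.
Hypothesis f_const : forall p q, adj p q ->
  t - w <= total p -> t - w <= total q -> f p = f q.

(** On an orbit whose switch does not decrease the total, the intermediate
    totals exceed a nonnegative partial sum of gains up to the one foreign
    value, which costs at most [w]. *)
Lemma switch_orbit p q x0 :
    let s := (q * p^-1)%g in t <= total p ->
    0 <= \sum_(y in porbit s x0) (W y (q y) - W y (p y)) ->
  exists p', [/\ t <= total p', f p' = f p &
    forall y, p' y = if y \in porbit s x0 then q y else p y].
Proof.
move=> s tp; have qE y : q y = p (s y) by rewrite permM permKV.
under eq_bigr do rewrite qE.
case/good_start => x xO x_ge0.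
have Ox : porbit s x = porbit s x0 by apply/eqP; rewrite eq_porbit_mem.
set L := #|porbit s x|.
have L0 : (0 < L)%N by rewrite lt0n card_porbit_neq0.
have big k : (k < L)%N -> t - w <= total (advance p s x k).
  move=> kL; have [_ _ _ ->] := advance_spec p kL.
  have := W_osc (iter k s x) (p (iter k s x)) (iter k s x) (p x).
  by have := x_ge0 k; lra.
have fE k : (k < L)%N -> f (advance p s x k) = f p.
  elim: k => [//|k IH] kL; rewrite -(IH (ltnW kL)); apply: f_const.
  - apply: adjC => /=; by eexists _, _.
  - exact: big.
  - exact/big/ltnW.
have LE : L.-1.+1 = L by rewrite prednK.
have [lo at_ hi tot] := advance_spec p (etrans (congr1 (leq^~ L) LE) (leqnn L)).
exists (advance p s x L.-1); split.
- rewrite tot; have := x_ge0 L; rewrite -LE /orbit_sum big_nat_recr //=.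
  rewrite -iterS LE iter_porbit -/(orbit_sum _ _ _ _); lra.
- by apply: fE; rewrite LE.
- move=> y; rewrite -Ox porbit_traject; case: ifP => [|yO].
    case/trajectP => i iL ->; rewrite qE -iterS.
    have : (i <= L.-1)%N by rewrite -ltnS LE.
    rewrite leq_eqVlt => /orP[/eqP->|iL1]; last by rewrite lo.
    by rewrite at_ LE iter_porbit.
  apply: hi => i iL; apply: contraFneq yO => ->.
  by apply/trajectP; exists i; rewrite // -/L -LE ltnS.
Qed.

(** The invariant [f] expresses connectedness: [p] and [q] are joined by
    transpositions inside the region where the total is at least [t - w]. The
    orbits on which [q] gains over [p] are switched starting from [p], the
    others starting from [q], so that the totals at both ends never
    decrease. *)
Lemma walk p q : t <= total p -> t <= total q -> f p = f q.
Proof.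
have [m] := ubnP #|[pred y | p y != q y]|.
elim: m p q => // m IH p q; rewrite ltnS => le_m tp tq.
have [->//|/eqP pq] := eqVneq p q.
have [x0 px0] : exists x, p x != q x.
  apply/existsP; apply: contra_notT pq; rewrite negb_exists => /forallP e.
  by apply/permP => x; apply/eqP; rewrite -[_ == _]negbK.
have closer p' q' : (forall y, p' y != q' y -> p y != q y) -> p' x0 = q' x0 ->
    (#|[pred y | p' y != q' y]| < m)%N.
  move=> sub e; apply: leq_trans le_m; apply: proper_card.
  apply/properP; split; first by apply/subsetP => y; rewrite !inE; apply: sub.
  by exists x0; rewrite !inE // e eqxx.
have [sgn|sgn] := lerP 0 (\sum_(y in porbit (q * p^-1)%g x0)
                           (W y (q y) - W y (p y))).
  have [p' [tp' <- p'E]] := switch_orbit tp sgn.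
  apply: IH => //; apply: closer; last by rewrite p'E porbit_id.
  by move=> y; rewrite p'E; case: ifP => //; rewrite eqxx.
have [|q' [tq' <- q'E]] := @switch_orbit q p x0 tq.
  have -> : (p * q^-1 = (q * p^-1)^-1)%g by rewrite invMg invgK.
  rewrite porbitV; apply: ltW; rewrite -oppr_lt0 -sumrN.
  by under eq_bigr do rewrite opprB.
apply: IH => //; apply: closer; last by rewrite q'E porbit_id.
by move=> y; rewrite q'E; case: ifP => //; rewrite eqxx.
Qed.

End Walk.

(** * Fair permutations of a coloured square *)

Section Colouring.
Variables (R : realFieldType) (n : nat).
Local Notation T := 'I_n.+1.
Variable col : T -> T -> 'I_3.
Implicit Types (p q : {perm T}) (i j : 'I_3) (x y : T).

Definition count i p : R := total (fun x y => (col x y == i)%:R) p.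
Definition mean i : R := (\sum_x \sum_y (col x y == i)%:R) / n.+1%:R.
Definition deviation p : R * R := (count 0 p - mean 0, count 1 p - mean 1).

Lemma sum_eq1 j : (j == 0)%:R + (j == 1)%:R + (j == 2)%:R = 1 :> R.
Proof.
by case: j => [[|[|[|]]]] // ?; rewrite -!val_eqE /= ?addr0 ?add0r.
Qed.

Lemma count_sum p : count 0 p + count 1 p + count 2 p = n.+1%:R.
Proof.
rewrite /count /total -!big_split /= (eq_bigr (fun=> 1)) => [|x _].
  by rewrite sumr_const card_ord.
exact: sum_eq1.
Qed.

Lemma mean_sum : mean 0 + mean 1 + mean 2 = n.+1%:R.
Proof.
rewrite /mean -!mulrDl -!big_split /= (eq_bigr (fun=> n.+1%:R)) => [|x _].
  by rewrite sumr_const card_ord -(mulr_natr n.+1%:R) mulfK // pnatr_eq0.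
rewrite -!big_split /= (eq_bigr (fun=> 1)) => [|y _].
  by rewrite sumr_const card_ord.
exact: sum_eq1.
Qed.

(** With [x + y + z = 0], a coordinate at least [2] in absolute value forces
    [x^2 + y^2 + z^2 >= 4 + 2]. *)
Lemma far_deviation p i : 2 <= `|count i p - mean i| -> far (deviation p).
Proof.
rewrite /far /dot /deviation /=.
set x := _ - mean 0; set y := _ - mean 1.
have z2 : count 2 p - mean 2 = - (x + y).
  by have := count_sum p; have := mean_sum; rewrite /x /y; lra.
have sq (z : R) : 2 <= `|z| -> 4 <= z ^+ 2.
  by move=> z2'; rewrite -real_normK ?num_real //; nra.
case: i => [[|[|[|//]]]] lti.
- rewrite (_ : Ordinal lti = 0); last exact: val_inj.
  by rewrite -/x => /sq; have := sqr_ge0 (x + 2 * y); nra.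
- rewrite (_ : Ordinal lti = 1); last exact: val_inj.
  by rewrite -/y => /sq; have := sqr_ge0 (y + 2 * x); nra.
rewrite (_ : Ordinal lti = 2); last exact: val_inj.
by rewrite z2 => /sq; have := sqr_ge0 (x - y); nra.
Qed.

(** A transposition removes two cells and adds two, so no coordinate changes by
    more than two. *)
Lemma close_deviation p q : adj p q -> close (deviation p) (deviation q).
Proof.
case=> x [y ->]; have [->|xy] := eqVneq x y.
  by rewrite tperm1 mul1g /close subrr /dot /= addr0 !mulr0 !addr0.
rewrite /close /dot /deviation /count !total_tperm //=.
set c1 := col x (p y); set c2 := col y (p x).
set c3 := col x (p x); set c4 := col y (p y).
have b j : [/\ 0 <= (j == 0)%:R :> R, 0 <= (j == 1)%:R :> R &
               (j == 0)%:R + (j == 1)%:R <= 1 :> R].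
  have := sum_eq1 j; have := ler0n R (j == 2).
  by split; rewrite ?ler0n //; lra.
have [? ? ?] := b c1; have [? ? ?] := b c2.
have [? ? ?] := b c3; have [? ? ?] := b c4.
by apply: hexagon_bound; rewrite ler_norml; apply/andP; split; lra.
Qed.

(** The products of [u] with the three sides [e_i - e_j], of squared length
    [2], are bounded by the Cauchy-Schwarz inequality. Taking their maximum as
    the width [w] avoids square roots. *)
Lemma width_bound (u : R * R) : u != 0 -> let a := 2 * u.1 + u.2 in
  let b := u.1 + 2 * u.2 in
  exists w, [/\ 0 < w, w ^+ 2 <= 2 * dot u u, `|a| <= w, `|b| <= w &
                `|a - b| <= w].
Proof.
move=> u0 a b; exists (Num.max `|a| (Num.max `|b| `|a - b|)).
have sq z : `|z| ^+ 2 = z ^+ 2 :> R by rewrite real_normK ?num_real.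
split; last 3 first.
- by rewrite le_max lexx.
- by rewrite !le_max lexx orbT.
- by rewrite !le_max lexx !orbT.
- rewrite lt_max normr_gt0; case: eqVneq => //= a0.
  rewrite lt_max normr_gt0; apply/orP; left.
  apply: contra_neq u0 => b0; move: a0 b0; rewrite /a /b.
  by case: (u) => u1 u2 /= a0 b0; congr (_, _); lra.
have sq_max (c d e : R) : `|c| ^+ 2 <= e -> d ^+ 2 <= e ->
  Num.max `|c| d ^+ 2 <= e.
  by case: (lerP `|c| d).
have h1 := sqr_ge0 u.1; have h2 := sqr_ge0 u.2.
have h3 := sqr_ge0 (u.1 + u.2); rewrite /dot.
apply: (sq_max); first by rewrite sq /a; nra.
by apply: (sq_max); rewrite sq /a /b; nra.
Qed.

(** Up to a constant, [dot u] of the deviation is a total of cell weights, to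
    which [walk] applies. *)
Definition weight (u : R * R) x y : R :=
  (2 * u.1 + u.2) * (col x y == 0)%:R + (u.1 + 2 * u.2) * (col x y == 1)%:R.

Lemma dot_deviation u p :
  dot u (deviation p) = total (weight u) p -
    ((2 * u.1 + u.2) * mean 0 + (u.1 + 2 * u.2) * mean 1).
Proof.
have -> : total (weight u) p =
    (2 * u.1 + u.2) * count 0 p + (u.1 + 2 * u.2) * count 1 p.
  by rewrite /total /weight big_split /= -!mulr_sumr.
by rewrite /dot /deviation /=; ring.
Qed.

Lemma weight_osc u w x y x' y' : 0 < w -> `|2 * u.1 + u.2| <= w ->
  `|u.1 + 2 * u.2| <= w -> `|2 * u.1 + u.2 - (u.1 + 2 * u.2)| <= w ->
  weight u x y - weight u x' y' <= w.
Proof.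
rewrite /weight; set a := _ + u.2; set b := u.1 + _ => w0.
rewrite !ler_norml => /andP[a1 a2] /andP[b1 b2] /andP[c1 c2].
by case: (col x y) => [[|[|[|]]]] // ?; case: (col x' y') => [[|[|[|]]]] // ?;
  rewrite -!val_eqE /= ?(mulr0, mulr1, addr0, add0r); lra.
Qed.

Definition shift (k : T) : {perm T} := perm (@addrI _ k).

(** The cyclic shifts partition the square. *)
Lemma count_shift i : \sum_k (count i (shift k) - mean i) = 0.
Proof.
rewrite sumrB sumr_const card_ord -(mulr_natr (mean i)) /mean divfK ?pnatr_eq0 //.
rewrite /count /total exchange_big /=; apply/eqP; rewrite subr_eq0; apply/eqP.
apply: eq_bigr => x _; rewrite [RHS](reindex_inj (@addIr _ x)) /=.
by apply: eq_bigr => k _; rewrite permE.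
Qed.

(** If every permutation were unfair, the half-turns of the deviations would
    have a potential on all permutations, and [walk] would determine its
    differences within half-planes; the cyclic shifts, whose deviations have
    sum zero, contradict this. *)
Theorem fair_permutation : exists p, forall i, `|count i p - mean i| < 2.
Proof.
suff /existsP[p /forallP Hp] : [exists p, [forall i, `|count i p - mean i| < 2]].
  by exists p.
apply: contraT => /existsPn bad.
have fv p : far (deviation p).
  by have /forallPn[i] := bad p; rewrite -leNgt => /far_deviation.
have v0 p : deviation p != 0.
  by apply: (@dot_neq0 _ (deviation p)); apply: lt_le_trans (fv p).
have [|K KE] :=
    @potential_exists _ (fun p q => turn (deviation p) (deviation q)).
  by move=> p q r s pq qr rs sp; apply: turn_square => //; apply: close_deviation.
have lift p q u : u != 0 ->
    0 <= dot u (deviation p) -> 0 <= dot u (deviation q) ->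
    K q - K p = turn u (deviation q) - turn u (deviation p).
  move=> u0 up uq; have [w [w0 w2 wa wb wab]] := width_bound u0.
  pose t := (2 * u.1 + u.2) * mean 0 + (u.1 + 2 * u.2) * mean 1.
  suff : K p - turn u (deviation p) = K q - turn u (deviation q) by lia.
  apply: (@walk _ _ (weight u) w t _ (fun r => K r - turn u (deviation r))).
  - by move=> *; apply: weight_osc.
  - move=> r s rs tr ts.
    suff : turn u (deviation s) - turn u (deviation r) = K s - K r by lia.
    rewrite -KE //; apply: (turn_halfplane w0) => //; first exact: close_deviation.
    + by rewrite dot_deviation -/t; lra.
    + by rewrite dot_deviation -/t; lra.
  - by move: up; rewrite dot_deviation subr_ge0.
  - by move: uq; rewrite dot_deviation subr_ge0.
have := @lift_unbalanced _ _ _ _ v0 lift _ shift ord0.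
by rewrite !count_shift eqxx => /(_ erefl).
Qed.

End Colouring.

(** * Perfect matchings as permutations *)

Section Edges.
Variables A B : finType.

Definition edge (x : A) (y : B) : {set (A + B)%type} := [set inl x; inr y].

Lemma inl_edge a x y : (inl a \in edge x y) = (a == x).
Proof. by rewrite !inE orbF. Qed.

Lemma inr_edge b x y : (inr b \in edge x y) = (b == y).
Proof. by rewrite !inE. Qed.

Lemma edge_inj x y x' y' : edge x y = edge x' y' -> x = x' /\ y = y'.
Proof.
move=> e; split; apply/eqP.
  by rewrite -(inl_edge x x' y') -e inl_edge.
by rewrite -(inr_edge y x' y') -e inr_edge.
Qed.

End Edges.

Lemma perfect_matching_perm (T : finType) (p : {perm T}) :
  perfect_matching (complete_bipartite T T) [set edge x (p x) | x : T].
Proof.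
apply/andP; split; first (apply/andP; split).
- apply/subsetP => _ /imsetP[x _ ->]; exact: imset2_f.
- apply/trivIsetP => _ _ /imsetP[x _ ->] /imsetP[y _ ->] xy.
  rewrite -setI_eq0; apply/eqP/setP => -[a|b]; rewrite !inE /= ?orbF.
    by apply: contra_neqF xy => /andP[/eqP[<-] /eqP[<-]].
  by apply: contra_neqF xy => /andP[/eqP[->] /eqP[/perm_inj->]].
- rewrite eqEsubset subsetT; apply/subsetP => -[a|b] _; apply/bigcupP.
    by exists (edge a (p a)); [apply: imset_f | rewrite inl_edge].
  exists (edge (p^-1 b)%g b); last by rewrite inr_edge.
  by apply/imsetP; exists (p^-1 b)%g; rewrite ?permKV.
Qed.

Theorem theorem6p1 (n : nat) (hn : (1 <= n)%N)
    (E : 'I_3 -> {set {set ('I_n + 'I_n)%type}})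
    (disjE : forall i j : 'I_3, i != j -> [disjoint E i & E j])
    (coverE : \bigcup_(i < 3) E i = complete_bipartite 'I_n 'I_n) :
  exists2 F : {set {set ('I_n + 'I_n)%type}},
    perfect_matching (complete_bipartite 'I_n 'I_n) F &
    forall i : 'I_3,
      (Num.floor (#|E i|%:R / n%:R : rat) - 1 <= #|F :&: E i|%:Z)
      /\ (#|F :&: E i|%:Z <= Num.ceil (#|E i|%:R / n%:R : rat) + 1).
Proof.
case: n hn E disjE coverE => // n _ E disjE coverE.
pose col x y := odflt 0 [pick i | edge x y \in E i].
have colE x y i : (edge x y \in E i) = (col x y == i).
  rewrite /col; case: pickP => [j xyj|no] /=; last first.
    have : edge x y \in \bigcup_(i < 3) E i by rewrite coverE imset2_f.
    by case/bigcupP => j _; rewrite no.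
  have [<-//|ji] := eqVneq j i.
  by apply/negP => xyi; have /disjointFr/(_ xyj) := disjE _ _ ji; rewrite xyi.
have [p Hp] := fair_permutation rat col.
exists [set edge x (p x) | x : 'I_n.+1]; first exact: perfect_matching_perm.
move=> i.
have cardF : #|[set edge x (p x) | x : 'I_n.+1] :&: E i|%:R = count rat col i p.
  have -> : [set edge x (p x) | x : 'I_n.+1] :&: E i =
            [set edge x (p x) | x : 'I_n.+1 in [pred x | col x (p x) == i]].
    apply/setP => e; apply/setIP/imsetP => [[/imsetP[x _ ->]]|[x xi ->]].
      by rewrite colE => xi; exists x.
    by split; [apply: imset_f | rewrite colE].
  rewrite card_imset => [|x y /edge_inj[]//].
  rewrite -sum1_card natr_sum /count /total big_mkcond /=.
  by apply: eq_bigr => x _; rewrite inE; case: eqP.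
have cardE : #|E i|%:R / n.+1%:R = mean rat col i.
  rewrite /mean; congr (_ / _); rewrite pair_big /=.
  have -> : E i = [set edge xy.1 xy.2 | xy in [pred xy | col xy.1 xy.2 == i]].
    apply/setP => e; apply/idP/imsetP => [ei|[[x y] xyi ->]]; last by rewrite colE.
    have : e \in complete_bipartite 'I_n.+1 'I_n.+1.
      by rewrite -coverE; apply/bigcupP; exists i.
    case/imset2P => x y _ _ exy; exists (x, y) => //=.
    by rewrite inE /= -colE /edge -exy.
  rewrite card_imset => [|[x y] [x' y'] /edge_inj[/= -> ->]//].
  rewrite -sum1_card natr_sum big_mkcond /=.
  by apply: eq_bigr => xy _; rewrite inE; case: eqP.
(* Rounding: an integer more than [floor a - 2] is at least [floor a - 1]. *)
have := Hp i; rewrite -cardF -cardE ltr_norml; set v := #|_|; set a := _ / _.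
have fl := floor_le a; have ce := ceil_ge a.
move=> /andP[lo hi]; split.
  rewrite -ltzD1 -(ltr_int rat) !intrD rmorphN /= -pmulrn.
  lra.
rewrite -ltzD1 -(ltr_int rat) !intrD /= -pmulrn.
lra.
Qed.
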